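(* Let $\varphi,u_1,u_2:\mathbb R_+^2\to\mathbb R_+$ each satisfy properties (I)–(IV) listed in the context. For any interior initial market state $\mathbf R^{\mathsf{in}}\in(\mathbb R_{++}^2)^3$, every unilateral equilibrium in $\mathcal U(\mathbf R^{\mathsf{in}})$ is Pareto optimal.
   Context: Notation: $\mathbb R_+=[0,\infty)$, $\mathbb R_{++}=(0,\infty)$. For a function $u$ that is differentiable with nonzero partial derivatives at $(x,y)$, put $p(u,x,y):=\partial_xu(x,y)/\partial_yu(x,y)$. Properties of a function $u:\mathbb R_+^2\to\mathbb R_+$: (I) $u$ is continuous, $u(x,0)=u(0,y)=0$ for all $x,y\in\mathbb R_+$, and $u$ is strictly increasing (in each coordinate) on $\mathbb R_{++}^2$. (II) $\lim_{x'\to\infty}u(x',y)=\infty$ and $\lim_{y'\to\infty}u(x,y')=\infty$ for every $x,y>0$. (III) $u$ is continuously differentiable and strictly concave on $\mathbb R_{++}^2$. (IV) For any $x_1,x_2,y_1,y_2\in\mathbb R_{++}$ with $x_1\le x_2$ and $y_1\ge y_2$, at least one inequality strict, $p(u,x_1,y_1)>p(u,x_2,y_2)$ whenever the prices are defined. Market: there is one constant-function market maker (CFMM) with trading function $\varphi$ and two agents with utilities $u_1,u_2$. A market state is $\mathbf R=(\mathbf r_0,\mathbf r_1,\mathbf r_2)\in(\mathbb R_+^2)^3$ ($\mathbf r_0$ = CFMM inventory, $\mathbf r_i$ = holding of agent $i$); it is interior if it lies in $(\mathbb R_{++}^2)^3$. For a market state $\mathbf R^{\mathsf{in}}$, the feasible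 set $\mathcal F(\mathbf R^{\mathsf{in}})$ is the set of market states $\mathbf R$ with $\mathbf r_0+\mathbf r_1+\mathbf r_2=\mathbf r_0^{\mathsf{in}}+\mathbf r_1^{\mathsf{in}}+\mathbf r_2^{\mathsf{in}}$ and $\varphi(\mathbf r_0)=\varphi(\mathbf r_0^{\mathsf{in}})$, and $\mathcal U(\mathbf R^{\mathsf{in}})=\{\mathbf R\in\mathcal F(\mathbf R^{\mathsf{in}}):u_i(\mathbf r_i)\ge u_i(\mathbf r_i^{\mathsf{in}}),\ i=1,2\}$. A trade $\mathbf h\in\mathbb R^2$ is valid for $\mathbf R$ and agent $i\in\{1,2\}$ if $\mathbf r_0+\mathbf h\in\mathbb R_+^2$, $\varphi(\mathbf r_0+\mathbf h)=\varphi(\mathbf r_0)$ and $\mathbf r_i-\mathbf h\in\mathbb R_+^2$. A market state is a unilateral equilibrium if for each agent $i$ there is no valid trade $\mathbf h$ with $u_i(\mathbf r_i-\mathbf h)>u_i(\mathbf r_i)$. A market state $\mathbf R^*$ is Pareto optimal if there is no $\mathbf R\in\mathcal F(\mathbf R^* )$ with $u_i(\mathbf r_i)\ge u_i(\mathbf r_i^* )$ for $i=1,2$ and strict inequality for at least one $i$. *)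

(* Defs.v *)
From HB Require Import structures.
From mathcomp Require Export all_boot all_order all_algebra.
From mathcomp Require Export all_classical all_reals all_analysis.
Set Implicit Arguments.
Unset Strict Implicit.
Unset Printing Implicit Defensive.
Import Order.TTheory GRing.Theory Num.Theory.
Import numFieldNormedType.Exports.
Local Open Scope classical_set_scope.
Local Open Scope ring_scope.

(* A function defined on the closed quadrant only is represented by a total
   function on R * R; no definition below depends on its values outside the
   closed quadrant. *)

Definition quadrant {R : realType} : set (R * R) :=
  [set z | 0 <= z.1 /\ 0 <= z.2].

Definition open_quadrant {R : realType} : set (R * R) :=
  [set z | 0 < z.1 /\ 0 < z.2].

Definition partial_x {R : realType} (u : R * R -> R) (z : R * R) : R :=
  'D_(1, 0) u z.

Definition partial_y {R : realType} (u : R * R -> R) (z : R * R) : R :=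
  'D_(0, 1) u z.

Definition price_defined {R : realType} (u : R * R -> R) (z : R * R) : Prop :=
  [/\ differentiable u z, partial_x u z != 0 & partial_y u z != 0].

Definition price {R : realType} (u : R * R -> R) (z : R * R) : R :=
  partial_x u z / partial_y u z.

Definition strictly_increasing_coord {R : realType} (u : R * R -> R) : Prop :=
  (forall x x' y : R, 0 < x -> 0 < y -> x < x' -> u (x, y) < u (x', y)) /\
  (forall x y y' : R, 0 < x -> 0 < y -> y < y' -> u (x, y) < u (x, y')).

Definition strictly_concave_on {R : realType} (A : set (R * R))
    (u : R * R -> R) : Prop :=
  forall (z w : R * R) (t : R), A z -> A w -> z != w -> 0 < t -> t < 1 ->
    t * u z + (1 - t) * u w < u (t *: z + (1 - t) *: w).

Definition continuously_differentiable_on {R : realType} (A : set (R * R))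
    (u : R * R -> R) : Prop :=
  forall z, A z -> [/\ differentiable u z,
    {for z, continuous (partial_x u)} & {for z, continuous (partial_y u)}].

Definition propI {R : realType} (u : R * R -> R) : Prop :=
  [/\ {within quadrant, continuous u},
      (forall x : R, 0 <= x -> u (x, 0) = 0),
      (forall y : R, 0 <= y -> u (0, y) = 0)
    & strictly_increasing_coord u].

Definition propII {R : realType} (u : R * R -> R) : Prop :=
  (forall y : R, 0 < y -> u (x, y) @[x --> +oo] --> +oo) /\
  (forall x : R, 0 < x -> u (x, y) @[y --> +oo] --> +oo).

Definition propIII {R : realType} (u : R * R -> R) : Prop :=
  continuously_differentiable_on open_quadrant u /\
  strictly_concave_on open_quadrant u.

Definition propIV {R : realType} (u : R * R -> R) : Prop :=
  forall x1 x2 y1 y2 : R, 0 < x1 -> 0 < x2 -> 0 < y1 -> 0 < y2 ->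
    x1 <= x2 -> y2 <= y1 -> x1 < x2 \/ y2 < y1 ->
    price_defined u (x1, y1) -> price_defined u (x2, y2) ->
    price u (x2, y2) < price u (x1, y1).

Definition regular_function {R : realType} (u : R * R -> R) : Prop :=
  (forall z, quadrant z -> 0 <= u z) /\
  [/\ propI u, propII u, propIII u & propIV u].

Record allocation (R : realType) := Allocation {
  cfmm : R * R;
  agent : 'I_2 -> R * R }.

Definition market_state {R : realType} (S : allocation R) : Prop :=
  quadrant (cfmm S) /\ forall i, quadrant (agent S i).

Definition interior_state {R : realType} (S : allocation R) : Prop :=
  open_quadrant (cfmm S) /\ forall i, open_quadrant (agent S i).

Definition total_holdings {R : realType} (S : allocation R) : R * R :=
  cfmm S + \sum_(i < 2) agent S i.

Definition feasible {R : realType} (phi : R * R -> R) (Sin : allocation R) :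
    set (allocation R) :=
  [set S | [/\ market_state S, total_holdings S = total_holdings Sin
             & phi (cfmm S) = phi (cfmm Sin)]].

Definition improving {R : realType} (phi : R * R -> R)
    (u : 'I_2 -> R * R -> R) (Sin : allocation R) : set (allocation R) :=
  [set S | feasible phi Sin S /\
           forall i, u i (agent Sin i) <= u i (agent S i)].

Definition valid_trade {R : realType} (phi : R * R -> R) (S : allocation R)
    (i : 'I_2) (h : R * R) : Prop :=
  [/\ quadrant (cfmm S + h), phi (cfmm S + h) = phi (cfmm S)
    & quadrant (agent S i - h)].

Definition unilateral_equilibrium {R : realType} (phi : R * R -> R)
    (u : 'I_2 -> R * R -> R) (S : allocation R) : Prop :=
  market_state S /\
  forall i, ~ exists h, valid_trade phi S i h /\
                        u i (agent S i) < u i (agent S i - h).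

Definition pareto_optimal {R : realType} (phi : R * R -> R)
    (u : 'I_2 -> R * R -> R) (S : allocation R) : Prop :=
  market_state S /\
  ~ exists S', [/\ feasible phi S S',
                   (forall i, u i (agent S i) <= u i (agent S' i))
                 & exists i, u i (agent S i) < u i (agent S' i)].

(* Main.v *)
Require Import Defs.
From mathcomp Require Import ring lra.

(** At an equilibrium the price of the market maker equals the price of each
    agent: otherwise some direction raises both the trading function at
    [r_0] and the utility of the agent, and the surplus of the trading function
    can be handed over to the agent.  Hence the gradients of [phi], [u_1] and
    [u_2] at the three holdings are positive multiples of one positive vector
    [(a, b)].  By strict concavity, every strict move of a holding that does not
    lower the corresponding function has positive value at the prices [(a, b)].
    The moves of the three holdings between feasible states sum to zero, so no
    feasible state can dominate the equilibrium. *)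

Set Implicit Arguments.
Unset Strict Implicit.
Unset Printing Implicit Defensive.
Import Order.TTheory GRing.Theory Num.Theory.
Import numFieldNormedType.Exports.
Local Open Scope classical_set_scope.
Local Open Scope ring_scope.

Section Quadrant.
Context {R : realType}.
Implicit Types (u phi : R * R -> R) (z w v r : R * R).

Lemma derive_partialE u z v : differentiable u z ->
  'D_v u z = v.1 * partial_x u z + v.2 * partial_y u z.
Proof.
move=> du; rewrite /partial_x /partial_y !deriveE //.
have -> : v = v.1 *: ((1, 0) : R * R) + v.2 *: ((0, 1) : R * R).
  by case: v => a b; congr pair; rewrite /= /GRing.scale /=; ring.
by rewrite linearD !linearZ /= /GRing.scale /=; congr (_ * _ + _ * _); ring.
Qed.

Lemma derive_gt0_near u z v : differentiable u z -> 0 < 'D_v u z ->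
  \forall t \near 0^'+, u z < u (z + t *: v).
Proof.
move=> du; rewrite /derive normed_module.cvg_at_rightE; last exact: diff_derivable.
set q := fun h : R => _; move=> q_gt0.
have q_cvg : cvg (q h @[h --> 0^'+]).
  apply/cvg_ex; exists ('D_v u z); apply: cvg_dnbhs_at_right.
  exact: diff_derivable.
near=> t.
have t_gt0 : 0 < t by near: t; exact: nbhs_right_gt.
have : 0 < q t by near: t; exact: (cvgr_gt _ q_cvg).
by rewrite /q /= pmulr_rgt0 ?invr_gt0// subr_gt0 addrC.
Unshelve. all: by end_near.
Qed.

(** For [0 < t < 1], concavity bounds the difference quotient at [z] along [w - z] below by
    [u w - u z]; let [t] tend to [0] from the right. *)
Lemma concave_le_derive u z w : propIII u -> open_quadrant z ->
  open_quadrant w -> u w - u z <= 'D_(w - z) u z.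
Proof.
move=> [C1 conc] z0 w0; have [du _ _] := C1 _ z0.
have [<-|zw] := eqVneq z w; first by rewrite derive_partialE//= !subrr !mul0r addr0.
rewrite /derive normed_module.cvg_at_rightE; last exact: diff_derivable.
apply: limr_ge.
  apply/cvg_ex; exists ('D_(w - z) u z); apply: cvg_dnbhs_at_right.
  exact: diff_derivable.
near=> t.
have t_gt0 : 0 < t by near: t; exact: nbhs_right_gt.
have t_lt1 : t < 1 by near: t; exact: nbhs_right_lt.
have -> : (u \o shift z) (t *: (w - z)) = u (t *: w + (1 - t) *: z).
  by rewrite /=; congr u; rewrite scalerBr scalerBl scale1r addrA addrAC.
have /ltW := conc w z t w0 z0 (negbT (contra_neqF (fun e => esym (eqP e)) zw)) t_gt0 t_lt1.
by rewrite /GRing.scale /= ler_pdivlMl//; lra.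
Unshelve. all: by end_near.
Qed.

Lemma strictly_concave_lt_derive u z w : propIII u -> open_quadrant z ->
  open_quadrant w -> z != w -> u w - u z < 'D_(w - z) u z.
Proof.
move=> u3 z0 w0 zw; have [C1 conc] := u3; have [du _ _] := C1 _ z0.
(* The limit loses strictness, so the weak bound is applied at the midpoint, where strict concavity
   leaves a gap, and doubled by linearity of the derivative in the direction. *)
pose m : R * R := 2^-1 *: z + (1 - 2^-1) *: w.
have m0 : open_quadrant m.
  move: z0 w0 => [? ?] [? ?]; split; rewrite /m /= /GRing.scale /=; lra.
have := concave_le_derive u3 z0 m0.
have := conc z w 2^-1 z0 w0 zw; rewrite -/m !derive_partialE //=.
rewrite /GRing.scale /=; lra.
Qed.

(** Strict monotonicity alone would allow a zero derivative; by concavity each partial derivative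
    dominates the positive increment over a unit step. *)
Lemma regular_partial_gt0 u z : regular_function u -> open_quadrant z ->
  0 < partial_x u z /\ 0 < partial_y u z.
Proof.
case: z => x y [_ [[_ _ _ [incx incy]] _ u3 _]] z0; have [x0 y0] := z0.
have [du _ _] := u3.1 _ z0.
have xS : x < x + 1 by lra.
have yS : y < y + 1 by lra.
split.
- have w0 : open_quadrant ((x + 1, y) : R * R) by split => /=; move: x0 y0 => /=; lra.
  have := concave_le_derive u3 z0 w0; have := incx x (x + 1) y x0 y0 xS.
  rewrite derive_partialE //= subrr mul0r addr0; lra.
- have w0 : open_quadrant ((x, y + 1) : R * R) by split => /=; move: x0 y0 => /=; lra.
  have := concave_le_derive u3 z0 w0; have := incy x y (y + 1) x0 y0 yS.
  rewrite derive_partialE //= subrr mul0r add0r; lra.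
Qed.

Lemma regular_gt0 u z : regular_function u -> open_quadrant z -> 0 < u z.
Proof.
case: z => x y [ge0 [[_ _ _ [incx _]] _ _ _]] [/= x0 y0].
(* Strict monotonicity is available only in the open quadrant, so the comparison point is
   [(x / 2, y)] rather than a point of the axis. *)
have x2 : 0 < x / 2 by lra.
apply: le_lt_trans (incx (x / 2) x y x2 y0 _); last by lra.
by apply: ge0; split => /=; lra.
Qed.

Lemma regular_gt0_open u z : regular_function u -> quadrant z -> 0 < u z ->
  open_quadrant z.
Proof.
case: z => x y [_ [[_ uy0 ux0 _] _ _ _]] [/= x0 y0] uz.
by split => /=; rewrite lt_neqAle ?x0 ?y0 andbT; apply: contraTN uz => /eqP <-;
  rewrite ?ux0 ?uy0 ?ltxx.
Qed.

(** Intermediate values on the horizontal segment from the axis, where [u] vanishes, to [z]. *)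
Lemma level_crossing u z c : propI u -> open_quadrant z -> 0 <= c -> c < u z ->
  exists x, [/\ 0 <= x, x < z.1 & u (x, z.2) = c].
Proof.
case: z => x y [cu _ ux0 _] [/= x0 y0] c0 cz.
have cont : {within `[0, x], continuous (fun s => u (s, y))}.
  apply/subspace_continuousP => s /=; rewrite in_itv/= => /andP[s0 sx].
  have q : quadrant ((s, y) : R * R) by split => //=; exact: ltW.
  have /subspace_continuousP/(_ _ q) := cu; apply: cvg_comp => A nA.
  have pc : (fun s : R => (s, y)) @ s --> ((s, y) : R * R).
    exact: (cvg_pair cvg_id (cvg_cst _)).
  suff: nbhs s (fun t : R => (t \in `[0, x]) -> A (t, y)) by [].
  apply: (@filterS _ (nbhs s) _ _ _ _ (pc _ nA)) => t At; rewrite in_itv/= => /andP[t0 tx].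
  by apply: At; split => //=; exact: ltW.
have [|s] := IVT (v := c) (ltW x0) cont.
  rewrite ux0 ?(ltW y0)//; apply/andP; split; first by rewrite ge_min c0.
  by rewrite le_max (ltW cz) orbT.
rewrite in_itv/= => /andP[s0 sx] us; exists s; split => //.
rewrite lt_neqAle sx andbT; apply: contraTneq cz => <-.
by rewrite us ltxx.
Qed.

Lemma open_quadrant_near z v : open_quadrant z ->
  \forall t \near 0^'+, open_quadrant (z + t *: v).
Proof.
move=> [z1 z2].
have coord (a b : R) : 0 < a -> \forall t \near 0^'+, 0 < a + t * b.
  move=> a0; have c : (a + t * b) @[t --> 0^'+] --> a + 0 * b.
    apply: cvg_at_right_filter; apply: cvgD; first exact: cvg_cst.
    by apply: cvgM; [exact: cvg_id|exact: cvg_cst].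
  by apply: (cvgr_gt _ c); rewrite mul0r addr0.
near=> t; split => /=; near: t; exact: coord.
Unshelve. all: by end_near.
Qed.

(* The trade moves along [v], then gives the surplus of [phi] to the agent in
   the first good. *)
Lemma improving_trade phi u r0 r v : regular_function phi ->
  regular_function u -> open_quadrant r0 -> open_quadrant r ->
  0 < 'D_v phi r0 -> 0 < 'D_(- v) u r ->
  exists h, [/\ quadrant (r0 + h), phi (r0 + h) = phi r0,
    quadrant (r - h) & u r < u (r - h)].
Proof.
move=> rphi ru r0_gt0 r_gt0 dphi du.
have [_ [phi1 _ phi3 _]] := rphi; have [_ [[_ _ _ [incx _]] _ u3 _]] := ru.
have [diffphi _ _] := phi3.1 _ r0_gt0; have [diffu _ _] := u3.1 _ r_gt0.
have [t [pt ut qt q't]] : exists t : R, [/\ phi r0 < phi (r0 + t *: v),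
    u r < u (r + t *: - v), open_quadrant (r0 + t *: v) &
    open_quadrant (r + t *: - v)].
  near (0 : R)^'+ => t; exists t; split; near: t.
  - exact: derive_gt0_near.
  - exact: derive_gt0_near.
  - exact: open_quadrant_near.
  - exact: open_quadrant_near.
have [x [x0 xlt phix]] :=
  level_crossing phi1 qt (ltW (regular_gt0 rphi r0_gt0)) pt.
exists ((x, (r0 + t *: v).2) - r0); rewrite addrC subrK.
set w := r - _.
have w1 : (r + t *: - v).1 < w.1 by move: xlt; rewrite /w /= /GRing.scale /=; lra.
have w2 : w.2 = (r + t *: - v).2 by rewrite /w /= /GRing.scale /=; ring.
have [q1 q2] := q't.
split => //.
- by split => //=; exact: ltW qt.2.
- by split; [exact: ltW (lt_trans q1 w1)|rewrite w2 ltW].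
- apply: (lt_trans ut); move: (incx _ w.1 _ q1 q2 w1); rewrite -w2.
  by rewrite -surjective_pairing {1}w2 -surjective_pairing.
Unshelve. all: by end_near.
Qed.

(** Equality of the two prices, cross-multiplied to avoid division. *)
Lemma equilibrium_gradients_parallel phi (u : 'I_2 -> R * R -> R)
    (S : allocation R) i :
  regular_function phi -> regular_function (u i) ->
  open_quadrant (cfmm S) -> open_quadrant (agent S i) ->
  unilateral_equilibrium phi u S ->
  partial_x phi (cfmm S) * partial_y (u i) (agent S i) =
  partial_x (u i) (agent S i) * partial_y phi (cfmm S).
Proof.
move=> rphi ru q0 qi [_ /(_ i) eqS].
have no_dir v : 0 < 'D_v phi (cfmm S) -> ~ 0 < 'D_(- v) (u i) (agent S i).
  move=> dphi du; apply: eqS.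
  by have [h [? ? ? ?]] := improving_trade rphi ru q0 qi dphi du; exists h.
have [_ [_ _ phi3 _]] := rphi; have [_ [_ _ u3 _]] := ru.
have [diffphi _ _] := phi3.1 _ q0; have [diffu _ _] := u3.1 _ qi.
(* Orthogonal to the sum of the two gradients, this direction gives both derivatives in [no_dir] the
   same value, the difference of the two sides of the goal; the opposite direction gives its
   negative. *)
have := no_dir (partial_y phi (cfmm S) + partial_y (u i) (agent S i),
  - (partial_x phi (cfmm S) + partial_x (u i) (agent S i))).
have := no_dir (- (partial_y phi (cfmm S) + partial_y (u i) (agent S i)),
  partial_x phi (cfmm S) + partial_x (u i) (agent S i)).
rewrite !derive_partialE //=.
set a := partial_x phi _; set b := partial_y phi _.
set c := partial_x _ _; set d := partial_y _ _ => dir1 dir2.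
have [ltd|gtd|//] := ltgtP (a * d) (c * b).
- by case: dir1; lra.
- by case: dir2; lra.
Qed.

Lemma concave_improvement_value u z w : regular_function u ->
  open_quadrant z -> open_quadrant w -> u z <= u w -> z != w ->
  0 < (w.1 - z.1) * partial_x u z + (w.2 - z.2) * partial_y u z.
Proof.
move=> [_ [_ _ u3 _]] z0 w0 le zw; have [du _ _] := u3.1 _ z0.
have := strictly_concave_lt_derive u3 z0 w0 zw; rewrite derive_partialE //=.
by lra.
Qed.

End Quadrant.

Theorem proposition6 (R : realType) (phi : R * R -> R)
    (u : 'I_2 -> R * R -> R) (Sin : allocation R) :
  regular_function phi -> (forall i, regular_function (u i)) ->
  interior_state Sin ->
  forall S : allocation R, improving phi u Sin S ->
    unilateral_equilibrium phi u S -> pareto_optimal phi u S.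
Proof.
move=> rphi ru [in0 ini] S [[[qS0 qSi] totS phiS] impS] eqS.
split; first by [].
case=> S' [[[q'0 q'i] tot' phi'] imp' [k ltk]].
(* Every holding of [S] and [S'] is interior: its function is at least as large there as at the
   interior initial holding, hence positive, whereas it vanishes on the axes. *)
have S0 : open_quadrant (cfmm S).
  by apply: (regular_gt0_open rphi) => //; rewrite phiS regular_gt0.
have S'0 : open_quadrant (cfmm S').
  by apply: (regular_gt0_open rphi) => //; rewrite phi' regular_gt0.
have Si i : open_quadrant (agent S i).
  apply: (regular_gt0_open (ru i)) => //.
  by apply: lt_le_trans (impS i); exact: regular_gt0.
have S'i i : open_quadrant (agent S' i).
  apply: (regular_gt0_open (ru i)) => //.
  by apply: lt_le_trans (imp' i); exact: regular_gt0.
pose a := partial_x phi (cfmm S); pose b := partial_y phi (cfmm S).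
have [a0 b0] : 0 < a /\ 0 < b := regular_partial_gt0 rphi S0.
pose value z w := (w.1 - z.1) * a + (w.2 - z.2) * b.
have value0 : 0 <= value (cfmm S) (cfmm S').
  have [->|neq] := eqVneq (cfmm S) (cfmm S').
    by rewrite /value !subrr !mul0r addr0.
  by apply/ltW/concave_improvement_value => //; rewrite phi'.
have value_gt0 i : agent S i != agent S' i -> 0 < value (agent S i) (agent S' i).
  move=> neq; have := concave_improvement_value (ru i) (Si i) (S'i i) (imp' i) neq.
  have := equilibrium_gradients_parallel rphi (ru i) S0 (Si i) eqS.
  have [] := regular_partial_gt0 (ru i) (Si i); rewrite -/a -/b /value.
  set c := partial_x _ _; set d := partial_y _ _ => c0 d0 par.
  set X := _ - _; set Y := _ - _ => pos.
  (* By [par], the gradient [(c, d)] of the agent is [d / b] times [(a, b)]; the factor [d] clears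
     the denominator. *)
  have : 0 < (X * a + Y * b) * d.
    have -> : (X * a + Y * b) * d = (X * c + Y * d) * b.
      by rewrite mulrDl -mulrA par; ring.
    exact: mulr_gt0.
  by rewrite pmulr_lgt0.
have value_ge0 i : 0 <= value (agent S i) (agent S' i).
  have [->|/value_gt0/ltW//] := eqVneq (agent S i) (agent S' i).
  by rewrite /value !subrr !mul0r addr0.
(* A strict gain in utility forces the holding of agent [k] to change. *)
have valuek : 0 < value (agent S k) (agent S' k).
  by apply: value_gt0; apply: contraTneq ltk => ->; rewrite ltxx.
have sum0 : value (cfmm S) (cfmm S') +
    \sum_(i < 2) value (agent S i) (agent S' i) = 0.
  move: tot'; rewrite /total_holdings !big_ord_recl !big_ord0 /value.
  move=> tot; have := congr1 fst tot; have := congr1 snd tot => /=.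
  rewrite !addr0 => e2 e1.
  by rewrite (canRL (addrK _) e1) (canRL (addrK _) e2); ring.
have : 0 < \sum_(i < 2) value (agent S i) (agent S' i).
  rewrite (bigD1 k) //= ltr_wpDr // sumr_ge0 // => i _; exact: value_ge0.
lra.
Qed.
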